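(* Let $n\ge 2$. If $S_1\in\{\{b,g\},\{b,s\},\{y,o\},\{g,s\}\}$ and $S_2\in\{\{r,y\},\{r,g\},\{y,g\},\{b,o\}\}$ then \[|J(T_n(S_1))|=|J(T_n(S_2))|=\prod_{j=1}^n C_j=\prod_{j=1}^n\frac{1}{j+1}\binom{2j}{j}=\prod_{1\le i\le j\le k\le n-1}\frac{i+j+2}{i+j},\] and \[F(J(T_n(S_1)),q)=F(J(T_n^*(S_2)),q)=\prod_{j=1}^n C_j(q).\]
   Context: Let $T_n$ be the set of triples $(c_1,c_2,c_3)$ of nonnegative integers with $c_1+c_2+c_3\le n-2$. To the colors $r,g,y,b,o,s$ associate $v_r=(1,0,0)$, $v_g=(0,1,0)$, $v_y=(0,0,1)$, $v_b=(-1,1,0)$, $v_o=(-1,0,1)$, $v_s=(0,1,-1)$. For a set $S$ of colors, $T_n(S)$ is the poset on $T_n$ whose order is the reflexive–transitive closure of $p<p+v_x$ for $x\in S$ and $p,p+v_x\in T_n$; $T_n^*(S)$ is its dual poset. $J(P)$ is the set of order ideals (down-closed subsets, including $\emptyset$) of $P$, and $F(J(P),q)=\sum_{I\in J(P)}q^{|I|}$. $C_j$ is the $j$th Catalan number, and $C_j(q)$ is the Carlitz–Riordan $q$-Catalan number defined by $C_0(q)=C_1(q)=1$ and $C_j(q)=\sum_{k=1}^j q^{k-1}C_{k-1}(q)C_{j-k}(q)$. *)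

(* Defs.v *)
(* MathComp world. *)
From HB Require Import structures.
From mathcomp Require Import all_boot all_order all_algebra.
From mathcomp Require Import zify.

Set Implicit Arguments.
Unset Strict Implicit.
Unset Printing Implicit Defensive.

Import Order.TTheory GRing.Theory Num.Theory.

Inductive color := Red | Green | Yellow | Blue | Orange | Silver.

Definition color_to_ord (x : color) : 'I_6 :=
  match x with
  | Red => inord 0 | Green => inord 1 | Yellow => inord 2
  | Blue => inord 3 | Orange => inord 4 | Silver => inord 5
  end.

Definition ord_to_color (i : 'I_6) : color :=
  nth Red [:: Red; Green; Yellow; Blue; Orange; Silver] i.

Lemma color_to_ordK : cancel color_to_ord ord_to_color.
Proof. by case; rewrite /ord_to_color /= inordK. Qed.

HB.instance Definition _ := Countable.copy color (can_type color_to_ordK).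
HB.instance Definition _ : isFinite color := CanIsFinite color_to_ordK.

Definition color_vector (x : color) : int * int * int :=
  match x with
  | Red    => (1, 0, 0)%R
  | Green  => (0, 1, 0)%R
  | Yellow => (0, 0, 1)%R
  | Blue   => (-1, 1, 0)%R
  | Orange => (-1, 0, 1)%R
  | Silver => (0, 1, -1)%R
  end.

(* The bound c_1 + c_2 + c_3 <= n - 2 forces every coordinate below n - 1, so
   nothing is lost by taking coordinates in 'I_n.-1 (for n >= 2; subtraction is
   truncated below that). *)
Definition triangle (n : nat) : Type :=
  {c : 'I_n.-1 * 'I_n.-1 * 'I_n.-1 | c.1.1 + c.1.2 + c.2 <= n - 2}.

HB.instance Definition _ n := Finite.on (triangle n).

Definition coords n (p : triangle n) : int * int * int :=
  ((val p).1.1%:Z, (val p).1.2%:Z, (val p).2%:Z)%R.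

Definition step n (S : {set color}) : rel (triangle n) :=
  fun p p' => [exists x in S, coords p' == (coords p + color_vector x)%R].

(* An alias of [triangle n], so that each set of colors carries its own order. *)
Definition tposet (n : nat) (S : {set color}) : Type := triangle n.

HB.instance Definition _ n S := Finite.on (tposet n S).

Definition tposet_le n S : rel (tposet n S) := connect (@step n S).

(* Every color strictly increases the linear form c_1 + 3 c_2 + 2 c_3, which
   gives antisymmetry. *)
Definition tweight n (p : triangle n) : nat :=
  (val p).1.1 + 3 * (val p).1.2 + 2 * (val p).2.

Lemma step_tweight n S (p p' : triangle n) :
  step S p p' -> tweight p < tweight p'.
Proof.
case/exists_inP=> x _ /eqP; rewrite /coords /tweight.
case: (val p) (val p') => [[a b] c] [[a' b'] c'] /=.
by case: x => -[]; lia.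
Qed.

Lemma tposet_le_tweight n S (p p' : tposet n S) :
  tposet_le p p' -> (p == p') || (tweight p < tweight p').
Proof.
case/connectP=> s; elim: s p => [|z s IHs] p /=; first by move=> _ ->; rewrite eqxx.
case/andP=> /step_tweight ltpz /IHs{}IHs /IHs /orP[/eqP <-|ltz].
  by rewrite ltpz orbT.
by rewrite (ltn_trans ltpz ltz) orbT.
Qed.

Lemma tposet_le_refl n S : reflexive (@tposet_le n S).
Proof. by move=> p; apply: connect0. Qed.

Lemma tposet_le_trans n S : transitive (@tposet_le n S).
Proof. exact: connect_trans. Qed.

Lemma tposet_le_anti n S : antisymmetric (@tposet_le n S).
Proof.
move=> p p' /andP[/tposet_le_tweight/orP[/eqP //|lt1]].
by case/tposet_le_tweight/orP=> [/eqP //|/(ltn_trans lt1)]; rewrite ltnn.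
Qed.

Fact tposet_display : Order.disp_t. Proof. exact: Order.Disp tt tt. Qed.

HB.instance Definition _ n S :=
  Order.Le_isPOrder.Build tposet_display (tposet n S)
    (@tposet_le_refl n S) (@tposet_le_anti n S) (@tposet_le_trans n S).

Lemma tposet_leE n S (p p' : tposet n S) :
  (p <= p')%O = connect (@step n S) p p'.
Proof. by []. Qed.

Definition order_ideals (d : Order.disp_t) (P : finPOrderType d) :
    {set {set P}} :=
  [set I : {set P} | [forall x in I, forall y : P, (y <= x)%O ==> (y \in I)]].

Definition ideal_gf (d : Order.disp_t) (P : finPOrderType d) : {poly int} :=
  (\sum_(I in order_ideals P) 'X^#|I|)%R.

(* [catalan_seq n] is the list [:: C_0; ...; C_n] given by the convolution
   recurrence for the Catalan numbers. *)
Fixpoint catalan_seq (n : nat) : seq nat :=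
  if n is m.+1 then
    let s := catalan_seq m in
    rcons s (\sum_(1 <= k < m.+2) nth 0 s k.-1 * nth 0 s (m.+1 - k))
  else [:: 1].

Definition catalan (n : nat) : nat := nth 0 (catalan_seq n) n.

Fixpoint qcatalan_seq (n : nat) : seq {poly int} :=
  if n is m.+1 then
    let s := qcatalan_seq m in
    rcons s (\sum_(1 <= k < m.+2)
               'X^(k.-1) * nth 0 s k.-1 * nth 0 s (m.+1 - k))%R
  else [:: 1%R].

Definition qcatalan (n : nat) : {poly int} := nth 0%R (qcatalan_seq n) n.

Lemma size_catalan_seq n : size (catalan_seq n) = n.+1.
Proof. by elim: n => //= n IHn; rewrite size_rcons IHn. Qed.

Lemma nth_catalan_seq n k : k <= n -> nth 0 (catalan_seq n) k = catalan k.
Proof.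
elim: n => [|n IHn]; first by rewrite leqn0 => /eqP->.
rewrite leq_eqVlt ltnS => /orP[/eqP-> // | lekn].
by rewrite /= nth_rcons size_catalan_seq ltnS lekn IHn.
Qed.

Lemma catalan0 : catalan 0 = 1.
Proof. by []. Qed.

Lemma catalan_rec j : 0 < j ->
  catalan j = \sum_(1 <= k < j.+1) catalan k.-1 * catalan (j - k).
Proof.
case: j => // j _; rewrite /catalan /= nth_rcons size_catalan_seq ltnn eqxx.
by apply: eq_big_nat => k hk; rewrite !nth_catalan_seq //; lia.
Qed.

Lemma size_qcatalan_seq n : size (qcatalan_seq n) = n.+1.
Proof. by elim: n => //= n IHn; rewrite size_rcons IHn. Qed.

Lemma nth_qcatalan_seq n k :
  k <= n -> nth 0%R (qcatalan_seq n) k = qcatalan k.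
Proof.
elim: n => [|n IHn]; first by rewrite leqn0 => /eqP->.
rewrite leq_eqVlt ltnS => /orP[/eqP-> // | lekn].
by rewrite /= nth_rcons size_qcatalan_seq ltnS lekn IHn.
Qed.

Lemma qcatalan0 : qcatalan 0 = 1%R.
Proof. by []. Qed.

Lemma qcatalan_rec j : 0 < j ->
  qcatalan j =
    (\sum_(1 <= k < j.+1) 'X^(k.-1) * qcatalan k.-1 * qcatalan (j - k))%R.
Proof.
case: j => // j _; rewrite /qcatalan /= nth_rcons size_qcatalan_seq ltnn eqxx.
by apply: eq_big_nat => k hk; rewrite !nth_qcatalan_seq //; lia.
Qed.

Lemma qcatalan1 : qcatalan 1 = 1%R.
Proof. by rewrite qcatalan_rec // big_nat1 qcatalan0 expr0 !mulr1. Qed.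

(* Main.v *)
Require Import Defs.
From HB Require Import structures.
From mathcomp Require Import all_boot all_order all_algebra.

From mathcomp Require Import zify ring.

(* In barycentric coordinates c_1, c_2, c_3 and c_0 = n - 2 - c_1 - c_2 - c_3,
   every color moves one unit from one coordinate to another. The sets S_1 are
   the pairs of moves with a common target, the sets S_2 those with a common
   source, so up to permuting the coordinates and dualizing S_2 all eight posets
   coincide. Fixing the coordinate that does not move splits the poset into
   components; with x one of the decreasing coordinates and h the increasing one,
   sending (x, h) to [x, x + h] turns the order of a component into inclusion of
   subintervals of a chain. The ideals of that order
   are enumerated by C_u(q) (decompose by the first singleton missing from the
   ideal), hence the product of the C_j(q). At q = 1 this gives the number of
   ideals, which complementation makes invariant under duality. *)

Set Implicit Arguments.
Unset Strict Implicit.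
Unset Printing Implicit Defensive.

Import Order.TTheory GRing.Theory Num.Theory.

(** * Ideals of a relation inside a subset *)

Section RelativeIdeals.
Variables (T : finType) (le : rel T).
Implicit Types A B D I : {set T}.

(** Working inside subsets [D] of one fixed type lets an ideal be decomposed repeatedly without
    forming subtypes. *)
Definition relative_ideal D I :=
  (I \subset D) && [forall p in I, forall p' in D, le p' p ==> (p' \in I)].

Definition relative_gf D : {poly int} :=
  (\sum_(I : {set T} | relative_ideal D I) 'X^#|I|)%R.

Lemma relative_idealP D I :
  reflect (I \subset D /\
           forall p p', p \in I -> p' \in D -> le p' p -> p' \in I)
          (relative_ideal D I).
Proof.
apply: (iffP andP) => -[sID clI]; split=> //.
  move=> p p' pI p'D lep.
  by move/forall_inP/(_ p pI)/forall_inP/(_ p' p'D)/implyP: clI; apply.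
apply/forall_inP=> p pI; apply/forall_inP=> p' p'D; apply/implyP; exact: clI.
Qed.

Lemma relative_gf0 : relative_gf set0 = 1%R.
Proof.
rewrite /relative_gf (big_pred1 set0) ?cards0 ?expr0 // => I /=.
apply/relative_idealP/eqP => [[]|->]; first by rewrite subset0 => /eqP.
by split=> // p p'; rewrite inE.
Qed.

(** With no relation between [A] and [B], an ideal of the union is an independent choice of an ideal
    in each part, and sizes add. *)
Lemma relative_gfU A B :
  [disjoint A & B] ->
  (forall p p', p \in A -> p' \in B -> le p p' = false /\ le p' p = false) ->
  relative_gf (A :|: B) = (relative_gf A * relative_gf B)%R.
Proof.
move=> dAB noAB; rewrite /relative_gf big_distrlr /= pair_big /=.
have split_subset (K1 K2 : {set T}) : K1 \subset A -> K2 \subset B ->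
    ((K1 :|: K2) :&: A = K1) * ((K1 :|: K2) :&: B = K2).
  move=> s1 s2; split; rewrite setIUl.
    rewrite (setIidPl s1) (disjoint_setI0 _) ?setU0 //.
    by rewrite disjoint_sym (disjointWr s2).
  rewrite (setIidPl s2) (disjoint_setI0 _) ?set0U //.
  exact: disjointWl s1 _.
rewrite (reindex_onto (fun K : {set T} * {set T} => K.1 :|: K.2)
                      (fun I => (I :&: A, I :&: B))) /=; last first.
  by move=> I /relative_idealP[sI _]; rewrite -setIUr (setIidPl sI).
apply: eq_big => [[K1 K2]|[K1 K2]] /=; last first.
  case/andP=> _ /eqP[E1 E2].
  rewrite -exprD cardsU disjoint_setI0 ?cards0 ?subn0 //.
  have s1 : K1 \subset A by rewrite -E1 subsetIr.
  have s2 : K2 \subset B by rewrite -E2 subsetIr.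
  exact: disjointWl s1 (disjointWr s2 dAB).
apply/andP/andP=> [[/relative_idealP[_ cl] /eqP[E1 E2]]|].
  have s1 : K1 \subset A by rewrite -E1 subsetIr.
  have s2 : K2 \subset B by rewrite -E2 subsetIr.
  split; apply/relative_idealP; split=> // p p' pK p'D lep.
    by rewrite -E1 inE p'D (cl p) ?inE ?pK ?p'D.
  by rewrite -E2 inE p'D (cl p) ?inE ?pK ?p'D ?orbT.
case=> /relative_idealP[s1 cl1] /relative_idealP[s2 cl2]; split; last first.
  by apply/eqP; congr (_, _); rewrite !split_subset.
apply/relative_idealP; split; first exact: setUSS.
move=> p p' /setUP[pK|pK] /setUP[p'D|p'D] lep; apply/setUP.
- by left; apply: cl1 lep.
- by have [] := noAB _ _ (subsetP s1 _ pK) p'D; rewrite lep.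
- by have [] := noAB _ _ p'D (subsetP s2 _ pK); rewrite lep.
- by right; apply: cl2 lep.
Qed.

End RelativeIdeals.

(** A failed [find] returns the length [u]; since [b u] is false, this default is also the first
    failing index, so [i = u] needs no separate case. *)
Lemma find_iotaE (b : pred nat) u i : i <= u -> ~~ b u ->
  (find (predC b) (iota 0 u) == i) = all b (iota 0 i) && ~~ b i.
Proof.
move=> leiu nbu; set f := find _ _.
have lefu : f <= u by rewrite -[X in _ <= X](size_iota 0) find_size.
have nbf : ~~ b f.
  have := lefu; rewrite leq_eqVlt => /orP[/eqP-> //|ltfu].
  have := @nth_find _ 0 (predC b) (iota 0 u).
  by rewrite has_find size_iota nth_iota //; apply.
have bf j : j < f -> b j.
  move=> ltjf; have := @before_find _ 0 (predC b) _ _ ltjf.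
  by rewrite nth_iota ?add0n /= => [/negbFE|]; lia.
apply/eqP/andP=> [<-|[/allP ball nbi]].
  by split=> //; apply/allP=> j; rewrite mem_iota => /andP[_ /bf].
apply/eqP; rewrite eqn_leq; apply/andP; split; rewrite leqNgt; apply/negP.
  by move/bf; apply/negP.
by move=> ltfi; case/negP: nbf; apply: ball; rewrite mem_iota.
Qed.

(** * Subinterval orders on a simplex and their ideals *)

Section Chart.
Variables (d : nat) (T : finType) (x h t : T -> nat).

(** Leaving open which coordinates play the roles of [x], [h], [t] lets one enumeration serve all
    eight posets. *)
Definition simplex_chart :=
  [/\ forall p p', x p = x p' -> h p = h p' -> t p = t p' -> p = p',
      forall a k s, a + k + s <= d -> exists p, [/\ x p = a, h p = k & t p = s]
    & forall p, x p + h p + t p <= d].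

Definition interval_le : rel T := fun p p' =>
  [&& t p == t p', x p' <= x p & x p + h p <= x p' + h p'].

(** A step of [e] lengthens the interval [x, x + h] by one unit, at its right end or at its left
    end, so paths realize exactly the inclusions. *)
Lemma connect_interval_le (e : rel T) :
  simplex_chart ->
  (forall p p', e p p' =
     [&& t p == t p', h p' == (h p).+1 &
         (x p' == x p) || ((x p').+1 == x p)]) ->
  connect e =2 interval_le.
Proof.
move=> [inj surj bd] eE p p'; apply/idP/idP.
  case/connectP=> s; elim: s p => [p _ ->|q s IHs p /=].
    by rewrite /interval_le eqxx !leqnn.
  case/andP; rewrite eE => epq /IHs{}IHs /IHs; rewrite /interval_le; lia.
have [m] := ubnP (h p' - h p); elim: m p => // m IHm p lem.
case/and3P=> /eqP Et lex leh.
have [Eh|neh] := eqVneq (h p) (h p').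
  rewrite (inj p p') ?connect0 //; lia.
(* Extend to the left until the left ends agree, then to the right; [q] stays inside the interval of
   [p'], hence inside the simplex. *)
have [q [qx qh qt]] : exists q,
    [/\ x q = (if x p == x p' then x p else (x p).-1),
    h q = (h p).+1 & t q = t p].
  by apply: surj; have := bd p'; case: eqP; lia.
apply: (@connect_trans _ _ q).
  by apply: connect1; rewrite eE; case: eqP qx; lia.
by apply: IHm; rewrite /interval_le; case: eqP qx; lia.
Qed.

(** In layer [s], these are the subintervals of [a, a + k + u - 2] of length at least [k]. The shift
    by 2 makes [u] the Catalan index: there are u - 1 minimal elements when u > 0, and the set is
    empty for u <= 1. *)
Definition chart_triangle s a u k :=
  [set p | [&& t p == s, a <= x p, k <= h p & x p + h p + 2 <= a + k + u]].

Lemma card_chart_segment s a k i : simplex_chart -> a + i + k + s <= d.+1 ->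
  #|[set p | [&& t p == s, h p == k, a <= x p & x p < a + i]]| = i.
Proof.
move=> [inj surj bd]; elim: i => [|i IHi] lei.
  by apply/eqP; rewrite cards_eq0; apply/eqP/setP=> p; rewrite !inE; lia.
have [|q [qx qh qt]] := surj (a + i) k s; first lia.
rewrite (_ : [set p | _] =
    q |: [set p | [&& t p == s, h p == k, a <= x p & x p < a + i]]).
  rewrite cardsU1 IHi ?inE; lia.
apply/setP=> p; rewrite !inE.
have [->|npq] := eqVneq p q; first lia.
suff: ~ [&& x p == x q, h p == h q & t p == t q] by lia.
by case/and3P=> /eqP ? /eqP ? /eqP ?; case/eqP: npq; apply: inj.
Qed.

(** Let [a + i, a + i + k] be the first minimal interval missing from an ideal. The ideal contains
    the [i] minimal intervals before it and nothing that contains it. What remains is an ideal on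
    the longer intervals ending before a + i + k and on those starting after a + i. These two
    triangles are incomparable, so the three pieces give q^i, C_i(q) and C_{u-i}(q) for the triangle
    of index u + 1. *)
Lemma relative_gf_chart_triangle s a u k :
  simplex_chart -> s + a + k + u <= d.+2 ->
  relative_gf interval_le (chart_triangle s a u k) = qcatalan u.
Proof.
move=> chart; have [inj surj bd] := chart; have [m] := ubnP u.
elim: m s a u k => // m IHm s a [|u] k ltum bnd.
  rewrite qcatalan0 -(relative_gf0 interval_le); congr relative_gf.
  by apply/setP=> p; rewrite !inE; lia.
rewrite qcatalan_rec // big_add1 /= big_mkord.
pose base (I : {set T}) i :=
  [exists p in I, [&& t p == s, h p == k & x p == a + i]].
(* There are [u] minimal intervals here; the value [u] means that all of them lie in [I]. *)
pose gap I := find (fun i => ~~ base I i) (iota 0 u).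
have gap_lt I : gap I < u.+1.
  by rewrite ltnS -[X in _ <= X](size_iota 0) find_size.
rewrite /relative_gf (partition_big (fun I => Ordinal (gap_lt I)) xpredT) //=.
apply: eq_bigr => i _.
set D := chart_triangle _ _ _ _.
pose B := [set p | [&& t p == s, h p == k, a <= x p & x p < a + i]].
pose D1 := chart_triangle s a i k.+1.
pose D2 := chart_triangle s (a + i).+1 (u - i) k.
have ltiu := ltn_ord i.
have cardB : #|B| = i by apply: card_chart_segment => //; lia.
rewrite -mulrA subSS -(IHm s a i k.+1) //; [|lia|lia].
rewrite -(IHm s (a + i).+1 (u - i) k) //; [|lia|lia].
rewrite -relative_gfU; first last.
- by move=> p p'; rewrite !inE /interval_le; lia.
- by rewrite -setI_eq0; apply/eqP/setP=> p; rewrite !inE; lia.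
rewrite -/D1 -/D2 /relative_gf big_distrr /=.
have BD12 p : p \in B -> p \in D1 :|: D2 = false by rewrite !inE; lia.
have gapP (I : {set T}) : I \subset D ->
    (gap I == i) = (B \subset I) && ~~ base I i.
  move=> sID.
  have baseE j : j < u -> forall q, x q = a + j -> h q = k -> t q = s ->
      base I j = (q \in I).
    move=> ltju q qx qh qt; rewrite /base.
    apply/exists_inP/idP => [[p pI /and3P[]]|qI].
      by move=> /eqP pt /eqP ph /eqP px; rewrite (inj q p) ?qx ?qh ?qt.
    by exists q => //; rewrite qx qh qt !eqxx.
  (* Position [u] lies just outside [D], as [find_iotaE] requires. *)
  have baseu : base I u = false.
    rewrite /base; apply/exists_inP=> -[p /(subsetP sID)]; rewrite !inE; lia.
  rewrite /gap find_iotaE ?baseu //; congr (_ && _).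
  apply/allP/subsetP => [allB p|sBI j].
    rewrite inE => /and4P[/eqP pt /eqP ph lea ltp].
    rewrite -(baseE (x p - a)); [|lia..].
    by apply: allB; rewrite mem_iota; lia.
  rewrite mem_iota => /andP[_ ltji].
  have [|q [qx qh qt]] := surj (a + j) k s; first lia.
  by rewrite (baseE j _ q) //; [apply: sBI; rewrite !inE; lia|lia].
(* Removing the forced minimal elements [B] matches the ideals of [D] with gap [i] to the ideals of
   [D1 :|: D2]. *)
rewrite (reindex_onto (fun J => B :|: J) (fun I => I :\: B)) /=; last first.
  move=> I /andP[/relative_idealP[sID _]].
  rewrite -val_eqE /= gapP // => /andP[sBI _].
  apply/setP=> p; rewrite in_setU in_setD.
  by case: (boolP (p \in B)) => //= /(subsetP sBI) ->.
have sBD : B \subset D by apply/subsetP=> p; rewrite !inE; lia.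
have sD12D : D1 :|: D2 \subset D by apply/subsetP=> p; rewrite !inE; lia.
have dB12 (J : {set T}) : J \subset D1 :|: D2 -> [disjoint B & J].
  move=> sJ; rewrite -setI_eq0; apply/eqP/setP=> p; rewrite in_setI in_set0.
  by apply/negP=> /andP[/BD12 pND /(subsetP sJ)]; rewrite pND.
have BJ_setD (J : {set T}) : ((B :|: J) :\: B == J) = [disjoint B & J].
  rewrite setDUl setDv set0U; apply/eqP/idP => [/setDidPl|dBJ].
    by rewrite disjoint_sym.
  by apply/setDidPl; rewrite disjoint_sym.
apply: eq_big => [J|J /andP[_]]; last first.
  rewrite BJ_setD => dBJ.
  by rewrite cardsU (disjoint_setI0 dBJ) cards0 subn0 exprD cardB.
rewrite BJ_setD -val_eqE /=; apply/andP/idP => [[/andP[]]|].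
  move=> /relative_idealP[sD cl]; rewrite gapP // => /andP[_ nbase] dBJ.
  have sJ : J \subset D1 :|: D2.
    apply/subsetP=> p pJ; have pBJ : p \in B :|: J by rewrite inE pJ orbT.
    have pD := subsetP sD p pBJ.
    have pB : p \in B = false by apply: (disjointFl dBJ).
    apply/negPn/negP=> pND.
    (* An element of [D] outside [B], [D1] and [D2] contains the missing minimal interval, which
       downward closure would then put in the ideal. *)
    have [leai geai] : x p <= a + i /\ a + i + k <= x p + h p.
      by move: pD pB pND; rewrite !inE; lia.
    have [|q [qx qh qt]] := surj (a + i) k s.
      by move: pD; rewrite inE; lia.
    case/negP: nbase; rewrite /base; apply/exists_inP.
    exists q; last by rewrite qx qh qt !eqxx.
    move: pD; rewrite inE => pD.
    by apply: (cl p) => //; rewrite ?inE /interval_le; lia.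
  apply/relative_idealP; split=> // p p' pJ p'D lep.
  have : p' \in B :|: J.
    by apply: (cl p) => //; [rewrite inE pJ orbT|apply: (subsetP sD12D)].
  by rewrite inE => /orP[/BD12|//]; rewrite p'D.
move=> /relative_idealP[sJ cl].
have sBJ : B :|: J \subset D by rewrite subUset sBD (subset_trans sJ).
split; last exact: dB12.
apply/andP; split; last first.
  rewrite gapP // subsetUl /= /base; apply/exists_inP=> -[p].
  rewrite inE => /orP[|/(subsetP sJ)]; rewrite !inE; lia.
apply/relative_idealP; split=> // p p' pBJ p'D lep; rewrite inE.
have [|p'B] := boolP (p' \in B) => //=.
move: pBJ; rewrite inE => /orP[pB|pJ].
  (* Elements of [B] have the least length [k], so nothing in [D] lies strictly below them. *)
  by case/negP: p'B; move: pB p'D lep; rewrite !inE /interval_le; lia.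
apply: (cl p) => //; have := subsetP sJ p pJ.
by move: p'B p'D lep; rewrite !inE /interval_le; lia.
Qed.

(** Distinct layers of [t] are incomparable, and layer [s] is the full triangle of index d + 2 -
    s. *)
Lemma interval_gf_chart : simplex_chart ->
  relative_gf interval_le setT = (\prod_(1 <= j < d.+3) qcatalan j)%R.
Proof.
move=> chart; have [_ _ bd] := chart.
have gf_layers s : s <= d.+1 ->
    relative_gf interval_le [set p | t p < s] =
    (\prod_(0 <= j < s) qcatalan (d.+2 - j))%R.
  elim: s => [_|s IHs les].
    by rewrite big_geq // -(relative_gf0 interval_le).
  rewrite big_nat_recr //= -IHs; last lia.
  rewrite -(relative_gf_chart_triangle (s := s) (a := 0) (k := 0) chart); last lia.
  rewrite -relative_gfU; first last.
  - by move=> p p'; rewrite !inE /interval_le; lia.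
  - by rewrite -setI_eq0; apply/eqP/setP=> p; rewrite !inE; lia.
  congr relative_gf; apply/setP=> p; rewrite !inE; have := bd p; lia.
have -> : [set: T] = [set p | t p < d.+1].
  by apply/setP=> p; rewrite !inE; have := bd p; lia.
(* The layers 0, ..., d give the indices d + 2 down to 2; the factor at j = 1 is 1. *)
rewrite gf_layers // [RHS]big_ltn // qcatalan1 mul1r big_nat_rev /= add0n.
rewrite (big_addn 0 _ 2) subn2 /=; apply: eq_big_nat => j ltj.
congr qcatalan; lia.
Qed.

End Chart.

(** * From relations to posets; duality and the value at q = 1 *)

Lemma ideal_gf_relative (disp : Order.disp_t) (P : finPOrderType disp) :
  ideal_gf P = relative_gf (fun p p' : P => (p <= p')%O) setT.
Proof.
apply: eq_bigl => I; rewrite /order_ideals inE /relative_ideal subsetT /=.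
by apply: eq_forallb => p; congr (_ ==> _); apply: eq_forallb => p'; rewrite inE.
Qed.

Lemma ideal_gf_chart d (disp : Order.disp_t) (P : finPOrderType disp)
    (x h t : P -> nat) :
  simplex_chart d x h t ->
  (forall p p' : P, (p <= p')%O = interval_le x h t p p') ->
  ideal_gf P = (\prod_(1 <= j < d.+3) qcatalan j)%R.
Proof.
move=> chart leE; rewrite ideal_gf_relative -(interval_gf_chart chart).
apply: eq_bigl => I; congr (_ && _); apply: eq_forallb => p.
by congr (_ ==> _); apply: eq_forallb => p'; rewrite leE.
Qed.

Lemma card_order_ideals_gf (disp : Order.disp_t) (P : finPOrderType disp) :
  (#|order_ideals P|%:Z = (ideal_gf P).[1])%R.
Proof.
rewrite /ideal_gf horner_sum -natz -sum1_card natr_sum.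
by apply: eq_bigr => I _; rewrite hornerXn expr1n.
Qed.

(** Complementation exchanges down-closed and up-closed sets. It carries the count for the dual of
    the [S2] poset back to the poset itself. *)
Lemma card_order_ideals_dual (disp : Order.disp_t) (P : finPOrderType disp) :
  #|order_ideals (P^d)%type| = #|order_ideals P|.
Proof.
rewrite -[RHS](card_imset _ (inv_inj (@setCK P))).
apply: eq_card => I; rewrite -[I in RHS]setCK mem_imset; last first.
  exact: inv_inj (@setCK P).
rewrite !inE; apply/forall_inP/forall_inP => cl p pI;
  apply/forallP=> p'; apply/implyP=> lep.
  rewrite inE; apply/negP=> p'I; move: pI; rewrite inE => /negP[].
  by have /forallP/(_ p)/implyP := cl _ p'I; apply.
apply/negPn/negP=> p'I; have p'C : p' \in ~: I by rewrite inE.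
have /forallP/(_ p)/implyP/(_ lep) := cl _ p'C.
by rewrite inE pI.
Qed.

Lemma qcatalan_horner1 j : ((qcatalan j).[1] = (catalan j)%:Z)%R.
Proof.
have [m] := ubnP j; elim: m j => // m IHm [|j] ltjm.
  by rewrite qcatalan0 catalan0 hornerC.
rewrite qcatalan_rec // catalan_rec // horner_sum -natz natr_sum.
apply: eq_big_nat => k lek.
by rewrite !hornerM hornerXn expr1n mul1r natrM !natz !IHm //; lia.
Qed.

(** * The colored posets in barycentric coordinates *)

Section Barycentric.
Variable n : nat.
Hypothesis n_ge2 : 2 <= n.
Implicit Type p : triangle n.

(* In the coordinates [bary 0, ..., bary 3], of sum n - 2, each color moves one
   unit from a coordinate i to a coordinate j: r, g, y, b, o, s are
   0 -> 1, 0 -> 2, 0 -> 3, 1 -> 2, 1 -> 3, 3 -> 2. *)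
Definition bary i p : nat :=
  let: (a, b, c) := val p in
  nth 0 [:: n - 2 - (a + b + c); a : nat; b : nat; c : nat] i.

Lemma bary0E p : bary 0 p = n - 2 - (bary 1 p + bary 2 p + bary 3 p).
Proof. by rewrite /bary; case: (val p) => [[a b] c]. Qed.

Lemma sum_bary p : bary 1 p + bary 2 p + bary 3 p <= n - 2.
Proof. by case: p => [[[a b] c] le_n]. Qed.

Lemma bary_inj p p' :
  bary 1 p = bary 1 p' -> bary 2 p = bary 2 p' ->
  bary 3 p = bary 3 p' -> p = p'.
Proof.
move=> e1 e2 e3; apply: val_inj; move: e1 e2 e3; rewrite /bary.
case: (val p) (val p') => [[a b] c] [[a' b'] c'] /= e1 e2 e3.
by congr (_, _, _); apply: val_inj.
Qed.

Lemma bary_surj a b c : a + b + c <= n - 2 ->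
  exists p, [/\ bary 1 p = a, bary 2 p = b & bary 3 p = c].
Proof.
move=> le_n.
have [lta [ltb ltc]] : a < n.-1 /\ b < n.-1 /\ c < n.-1 by lia.
by exists (exist _ (Ordinal lta, Ordinal ltb, Ordinal ltc) le_n).
Qed.

(** The fixed sum determines the fourth coordinate, so any three of the four serve as a chart. *)
Lemma bary_chart i j k : i < 4 -> j < 4 -> k < 4 -> uniq [:: i; j; k] ->
  simplex_chart (n - 2) (bary i) (bary j) (bary k).
Proof.
move=> lti ltj ltk uniq_ijk; split.
- move=> p p' ei ej ek; have lep := sum_bary p; have lep' := sum_bary p'.
  apply: bary_inj; move: i j k lti ltj ltk uniq_ijk ei ej ek;
  by do 3![case=> [|[|[|[|//]]]]] => //; rewrite ?bary0E; lia.
- move=> a b c le_n.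
  (* [v] lists all four coordinates of the wanted point, the omitted one receiving the remainder. *)
  pose v m := if m == i then a else if m == j then b else
    if m == k then c else n - 2 - (a + b + c).
  have [|p [e1 e2 e3]] := @bary_surj (v 1) (v 2) (v 3).
    rewrite /v; move: i j k lti ltj ltk uniq_ijk {v};
    by do 3![case=> [|[|[|[|//]]]]] => //=; lia.
  exists p; move: e1 e2 e3; rewrite /v; move: i j k lti ltj ltk uniq_ijk {v};
  by do 3![case=> [|[|[|[|//]]]]] => //= _ _ _ _ e1 e2 e3; split;
     rewrite // bary0E; lia.
- move=> p; have lep := sum_bary p; move: i j k lti ltj ltk uniq_ijk;
  by do 3![case=> [|[|[|[|//]]]]] => //; rewrite ?bary0E; lia.
Qed.

Lemma step_set2E X Y p p' : step [set X; Y] p p' =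
  (coords p' == (coords p + color_vector X)%R) ||
  (coords p' == (coords p + color_vector Y)%R).
Proof.
apply/exists_inP/orP => [[Z /set2P[]-> eZ]|[eZ|eZ]]; [by left|by right|..].
  by exists X; rewrite // set21.
by exists Y; rewrite // set22.
Qed.

Lemma coords_addE p p' v : (coords p' == (coords p + v)%R) =
  [&& ((bary 1 p')%:Z == (bary 1 p)%:Z + v.1.1)%R,
      ((bary 2 p')%:Z == (bary 2 p)%:Z + v.1.2)%R &
      ((bary 3 p')%:Z == (bary 3 p)%:Z + v.2)%R].
Proof.
rewrite /coords /bary.
case: (val p) (val p') v => [[a b] c] [[a' b'] c'] [[u v] w].
by rewrite -!pair_eqE /= /pair_eq /= -pair_eqE /= andbA.
Qed.

(** One unit enters [j], either from the fourth coordinate ([i] unchanged) or from [i]; the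
    coordinate [k] is fixed. *)
Definition cover i j k : rel (triangle n) := fun p p' =>
  [&& bary k p == bary k p', bary j p' == (bary j p).+1 &
      (bary i p' == bary i p) || ((bary i p').+1 == bary i p)].

Lemma ideal_gf_cover (S : {set color}) i j k :
  i < 4 -> j < 4 -> k < 4 -> uniq [:: i; j; k] ->
  step S =2 cover i j k ->
  ideal_gf (tposet n S) = (\prod_(1 <= j < n.+1) qcatalan j)%R.
Proof.
move=> lti ltj ltk uniq_ijk stepE.
have chart := bary_chart lti ltj ltk uniq_ijk.
have -> : n.+1 = (n - 2).+3 by lia.
apply: (@ideal_gf_chart _ _ (tposet n S) _ _ _ chart) => p p'.
by rewrite tposet_leE (connect_interval_le chart stepE).
Qed.

Lemma ideal_gf_dual_cover (S : {set color}) i j k :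
  i < 4 -> j < 4 -> k < 4 -> uniq [:: i; j; k] ->
  (forall p p', step S p' p = cover i j k p p') ->
  ideal_gf ((tposet n S)^d)%type = (\prod_(1 <= j < n.+1) qcatalan j)%R.
Proof.
move=> lti ltj ltk uniq_ijk stepE.
have chart := bary_chart lti ltj ltk uniq_ijk.
have -> : n.+1 = (n - 2).+3 by lia.
apply: (@ideal_gf_chart _ _ ((tposet n S)^d)%type _ _ _ chart) => p p'.
rewrite -(@connect_interval_le _ _ _ _ _ [rel q q' | step S q' q] chart stepE).
by rewrite connect_rev.
Qed.

Lemma ideal_gf_V (S : {set color}) :
  S \in [:: [set Blue; Green]; [set Blue; Silver];
             [set Yellow; Orange]; [set Green; Silver]] ->
  ideal_gf (tposet n S) = (\prod_(1 <= j < n.+1) qcatalan j)%R.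
Proof.
rewrite !inE => /or4P[] /eqP->.
- apply: (@ideal_gf_cover _ 1 2 3) => // p p'.
  by rewrite step_set2E !coords_addE /cover /=; lia.
- apply: (@ideal_gf_cover _ 1 2 0) => // p p'.
  (* [bary 0] is a truncated subtraction; these bounds make it exact. *)
  have := sum_bary p; have := sum_bary p'.
  by rewrite step_set2E !coords_addE /cover !bary0E /=; lia.
- apply: (@ideal_gf_cover _ 1 3 2) => // p p'.
  by rewrite step_set2E !coords_addE /cover /=; lia.
apply: (@ideal_gf_cover _ 3 2 1) => // p p'.
by rewrite step_set2E !coords_addE /cover /=; lia.
Qed.

Lemma ideal_gf_dual_Lambda (S : {set color}) :
  S \in [:: [set Red; Yellow]; [set Red; Green];
             [set Yellow; Green]; [set Blue; Orange]] ->
  ideal_gf ((tposet n S)^d)%type = (\prod_(1 <= j < n.+1) qcatalan j)%R.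
Proof.
rewrite !inE => /or4P[] /eqP->.
- apply: (@ideal_gf_dual_cover _ 1 0 2) => // p p'.
  have := sum_bary p; have := sum_bary p'.
  by rewrite step_set2E !coords_addE /cover !bary0E /=; lia.
- apply: (@ideal_gf_dual_cover _ 1 0 3) => // p p'.
  have := sum_bary p; have := sum_bary p'.
  by rewrite step_set2E !coords_addE /cover !bary0E /=; lia.
- apply: (@ideal_gf_dual_cover _ 3 0 1) => // p p'.
  have := sum_bary p; have := sum_bary p'.
  by rewrite step_set2E !coords_addE /cover !bary0E /=; lia.
apply: (@ideal_gf_dual_cover _ 2 1 0) => // p p'.
have := sum_bary p; have := sum_bary p'.
by rewrite step_set2E !coords_addE /cover !bary0E /=; lia.
Qed.

End Barycentric.

(** * Closed forms of the Catalan numbers and of their product *)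

Section CatalanClosedForms.
Local Open Scope ring_scope.

Definition central_binomial n : rat := 'C(2 * n, n)%:R.

Lemma central_binomial0 : central_binomial 0 = 1.
Proof. by []. Qed.

Lemma central_binomialS n :
  central_binomial n.+1 = 2 * (2 * n%:R + 1) / n.+1%:R * central_binomial n.
Proof.
have n1 : n.+1%:R != 0 :> rat by rewrite pnatr_eq0.
rewrite /central_binomial.
have e : (n.+1 * 'C(2 * n.+1, n.+1) = 2 * (2 * n + 1) * 'C(2 * n, n))%N.
  (* Both identities involve C(2n+1, n), which [nia] eliminates. *)
  have := mul_bin_diag (2 * n).+2 n; have := mul_bin_down (2 * n).+1 n => /=.
  rewrite (_ : (2 * n).+1 - n = n.+1)%N; last lia.
  rewrite (_ : 2 * n.+1 = (2 * n).+2)%N; last lia.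
  nia.
move/(congr1 (fun k => k%:R : rat)): e; rewrite !natrM natrD natrM => e.
apply: (mulfI n1); rewrite e; field.
by rewrite -natr1 addrC in n1.
Qed.

(** This is the Catalan recurrence for the closed form. The sum telescopes, each end contributing
    half of the result. *)
Lemma sum_central_binomial n :
  \sum_(0 <= i < n.+1) central_binomial i / i.+1%:R *
    (central_binomial (n - i) / (n - i).+1%:R) =
  central_binomial n.+1 / n.+2%:R.
Proof.
(* Gosper's antidifference of the summand. *)
pose g j := central_binomial j * central_binomial (n.+1 - j) *
  (2 * j%:R - n.+1%:R) / (2 * n.+1%:R * n.+2%:R).
have nz c k : c.+1%:R + k%:R != 0 :> rat by rewrite -natrD pnatr_eq0.
rewrite (eq_big_nat _ _ (F2 := fun i => g i.+1 - g i)) => [|i /andP[_ lti]].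
  rewrite telescope_sumr // /g subnn subn0.
  rewrite central_binomial0 mulr0 sub0r !mulr1 !mul1r.
  by field; rewrite (nz 0) (nz 1).
rewrite /g; have [m ->] : exists m, n = (i + m)%N by exists (n - i)%N; lia.
rewrite (_ : (i + m).+1 - i.+1 = m)%N; last lia.
rewrite (_ : (i + m).+1 - i = m.+1)%N; last lia.
rewrite (_ : i + m - i = m)%N; last lia.
rewrite !central_binomialS; field.
by rewrite -natrD (nz 0) (nz 0) (nz 0) (nz 1).
Qed.

Lemma catalanE j : (catalan j)%:R = central_binomial j / j.+1%:R :> rat.
Proof.
have [m] := ubnP j; elim: m j => // m IHm [|j] ltjm.
  by rewrite catalan0 central_binomial0 mulr1n divr1.
rewrite catalan_rec // natr_sum -sum_central_binomial big_add1 /=.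
by apply: eq_big_nat => k lek; rewrite natrM subSS !IHm //; lia.
Qed.

(** The product telescopes with stride 2, leaving two factors at each end. *)
Lemma prod_nat_shift (m l : nat) :
  \prod_(1 <= i < l.+1) ((i + m + 2)%:R / (i + m)%:R) =
  (l + m + 1)%:R * (l + m + 2)%:R / (m.+1%:R * m.+2%:R) :> rat.
Proof.
have nz c k : c.+1%:R + k%:R != 0 :> rat by rewrite -natrD pnatr_eq0.
elim: l => [|l IHl].
  by rewrite big_geq // !add0n addn1 addn2 divff // -natrM pnatr_eq0.
rewrite big_nat_recr //= IHl (_ : l.+1 + m = (l + m).+1)%N // !addnS !addn0.
by field; rewrite -(natrD _ l m) (nz 0) (nz 0) (nz 1).
Qed.

(** Raising [n] by one adds the column j = n + 1, whose product [prod_nat_shift] evaluates to the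
    ratio of consecutive Catalan numbers. *)
Lemma prod_prod_central_binomial n :
  \prod_(1 <= i < n.+1) \prod_(i <= j < n.+1) ((i + j + 2)%:R / (i + j)%:R) =
  central_binomial n.+1 / n.+2%:R :> rat.
Proof.
have nz c k : c.+1%:R + k%:R != 0 :> rat by rewrite -natrD pnatr_eq0.
elim: n => [|n IHn]; first by rewrite big_geq.
rewrite (eq_big_nat _ _ (F2 := fun i =>
    (\prod_(i <= j < n.+1) ((i + j + 2)%:R / (i + j)%:R)) *
    ((i + n.+1 + 2)%:R / (i + n.+1)%:R))); last first.
  by move=> i /andP[_ lti]; rewrite big_nat_recr.
rewrite big_split /= [X in X * _]big_nat_recr //=.
rewrite [X in _ * X * _]big_geq // mulr1 IHn.
rewrite prod_nat_shift (central_binomialS n.+1).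
rewrite (_ : n.+1 + n.+1 + 1 = (2 * n + 2).+1)%N; last lia.
rewrite (_ : n.+1 + n.+1 + 2 = (2 * n + 3).+1)%N; last lia.
by field; rewrite (nz 1) (nz 2).
Qed.

(** The factors do not depend on [k], so the slab k = n of the triple product is the double product
    for C_{n+1}. *)
Lemma prod_central_binomial n :
  \prod_(1 <= j < n.+1) (central_binomial j / j.+1%:R) =
  \prod_(1 <= i < n) \prod_(i <= j < n) \prod_(j <= k < n)
         ((i + j + 2)%:R / (i + j)%:R) :> rat.
Proof.
elim: n => [|n IHn]; first by rewrite !big_geq.
rewrite big_nat_recr //= {}IHn.
case: n => [|n]; first by rewrite !big_geq // big_geq // mul1r.
rewrite -prod_prod_central_binomial.
set f := fun i j : nat => (i + j + 2)%:R / (i + j)%:R : rat.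
(* The range of [i], and later that of [j], gains an index with empty inner product, so that the
   products merge termwise. *)
have -> :
    \prod_(1 <= i < n.+1) \prod_(i <= j < n.+1) \prod_(j <= k < n.+1) f i j =
    \prod_(1 <= i < n.+2) \prod_(i <= j < n.+1) \prod_(j <= k < n.+1) f i j.
  by rewrite [RHS]big_nat_recr //= (big_geq (leqnn n.+1)) mulr1.
rewrite -big_split /=; apply: eq_big_nat => i /andP[_ lti].
rewrite [RHS](eq_big_nat _ _
  (F2 := fun j => (\prod_(j <= k < n.+1) f i j) * f i j)).
  rewrite [RHS]big_split /=.
  by rewrite [in RHS]big_nat_recr //= (big_geq (leqnn n.+1)) mulr1.
by move=> j /andP[_ ltj]; rewrite big_nat_recr.
Qed.

End CatalanClosedForms.

Theorem theorem9 (n : nat) (S1 S2 : {set color}) :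
  2 <= n ->
  S1 \in [:: [set Blue; Green]; [set Blue; Silver];
             [set Yellow; Orange]; [set Green; Silver]] ->
  S2 \in [:: [set Red; Yellow]; [set Red; Green];
             [set Yellow; Green]; [set Blue; Orange]] ->
  (#|order_ideals (tposet n S1)| = #|order_ideals (tposet n S2)| /\
   #|order_ideals (tposet n S2)| = \prod_(1 <= j < n.+1) catalan j /\
   ((\prod_(1 <= j < n.+1) catalan j)%:R
     = \prod_(1 <= j < n.+1) (1 / j.+1%:R * 'C(2 * j, j)%:R) :> rat)%R /\
   (\prod_(1 <= j < n.+1) (1 / j.+1%:R * 'C(2 * j, j)%:R)
     = \prod_(1 <= i < n) \prod_(i <= j < n) \prod_(j <= k < n)
         ((i + j + 2)%:R / (i + j)%:R) :> rat)%R) /\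
  (ideal_gf (tposet n S1) = ideal_gf ((tposet n S2)^d)%type /\
   (ideal_gf ((tposet n S2)^d)%type = \prod_(1 <= j < n.+1) qcatalan j)%R).

Proof.
move=> n_ge2 S1P S2P.
have gf1 := ideal_gf_V n_ge2 S1P; have gf2 := ideal_gf_dual_Lambda n_ge2 S2P.
have prod_horner1 : ((\prod_(1 <= j < n.+1) qcatalan j).[1] =
    (\prod_(1 <= j < n.+1) catalan j)%N%:Z :> int)%R.
  rewrite horner_prod -natz natr_prod; apply: eq_bigr => j _.
  by rewrite qcatalan_horner1 natz.
have card1 : #|order_ideals (tposet n S1)| = \prod_(1 <= j < n.+1) catalan j.
  by apply/eqP; rewrite -eqz_nat card_order_ideals_gf gf1 prod_horner1.
have card2 : #|order_ideals (tposet n S2)| = \prod_(1 <= j < n.+1) catalan j.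
  (* The generating function is known for the dual only, so the count passes through it. *)
  apply/eqP; rewrite -card_order_ideals_dual -eqz_nat card_order_ideals_gf.
  by rewrite gf2 prod_horner1.
have closed_form : (\prod_(1 <= j < n.+1) (1 / j.+1%:R * 'C(2 * j, j)%:R) =
    \prod_(1 <= j < n.+1) (central_binomial j / j.+1%:R) :> rat)%R.
  by apply: eq_bigr => j _; rewrite mul1r mulrC.
split; split; rewrite ?card1 ?card2 ?gf1 ?gf2 //; split=> //.
rewrite closed_form prod_central_binomial; split=> //.
rewrite -prod_central_binomial natr_prod.
by apply: eq_bigr => j _; rewrite catalanE.
Qed.
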